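(* Let $A\in\mathbb{R}^{n\times n}$, $b,x_0\in\mathbb{R}^n$, $r_0=b-Ax_0$, and let $\ell$ be the maximal dimension of the Krylov subspaces $\mathcal{K}_k(A,r_0)$, $k\ge0$. Suppose $\mathrm{range}(A)=\mathrm{range}(A^\top)$, $b\notin\mathrm{range}(A)$, and $x_0\in\mathrm{range}(A)$. Let $x_{\ell-1}$ be the $(\ell-1)$th GMRES iterate, i.e. $$x_{\ell-1}=\operatorname*{argmin}_{x\in x_0+\mathcal{K}_{\ell-1}(A,r_0)}\|b-Ax\|,$$ let $r_{\ell-1}=b-Ax_{\ell-1}$, and define $$\widetilde{x}_{\ell-1}=x_{\ell-1}-\frac{r_{\ell-1}^\top(x_{\ell-1}-x_0)}{r_{\ell-1}^\top r_{\ell-1}}\,r_{\ell-1}.$$ Then $\widetilde{x}_{\ell-1}$ is the pseudoinverse solution of $Ax=b$, i.e. $\widetilde{x}_{\ell-1}=A^\dagger b$.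
   Context: For a matrix $A\in\mathbb{R}^{n\times n}$ and a vector $v\in\mathbb{R}^n$, the $k$th Krylov subspace is $\mathcal{K}_k(A,v)=\mathrm{span}\{v,Av,\ldots,A^{k-1}v\}$, with $\mathcal{K}_0(A,v)=\{0\}$. The integer $\ell$ is characterized by $\dim\mathcal{K}_k(A,r_0)=k$ for $k\le\ell$ and $\dim\mathcal{K}_k(A,r_0)=\ell$ for $k\ge\ell+1$. $A^\dagger$ denotes the Moore--Penrose inverse of $A$; the vector $A^\dagger b$ is called the pseudoinverse solution of $Ax=b$. $\|\cdot\|$ is the Euclidean norm. *)

(* Defs.v *)
From mathcomp Require Import all_boot all_order all_algebra.
From mathcomp Require Import reals.

Set Implicit Arguments.
Unset Strict Implicit.
Unset Printing Implicit Defensive.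

Import Order.TTheory GRing.Theory Num.Theory.
Local Open Scope ring_scope.

Section RealMatrices.
Variable R : realType.

Definition dotcv n (u v : 'cV[R]_n) : R := (u^T *m v) 0 0.

Definition enorm n (v : 'cV[R]_n) : R := Num.sqrt (\sum_i v i 0 ^+ 2).

Definition mxrange m n (A : 'M[R]_(m, n)) : {vspace 'cV[R]_m} :=
  limg (linfun (mulmx A : 'cV[R]_n -> 'cV[R]_m)).

Lemma mxrangeP m n (A : 'M[R]_(m, n)) (y : 'cV[R]_m) :
  reflect (exists x : 'cV[R]_n, y = A *m x) (y \in mxrange A).
Proof.
apply: (iffP memv_imgP) => [[x _ ->]|[x ->]].
  by exists x; rewrite lfunE.
by exists x; rewrite ?memvf ?lfunE.
Qed.

Definition krylov n (A : 'M[R]_n) (v : 'cV[R]_n) (k : nat) :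
    {vspace 'cV[R]_n} :=
  <<mkseq (fun i => A ^+ i *m v) k>>%VS.

Definition max_krylov_dim n (A : 'M[R]_n) (v : 'cV[R]_n) (l : nat) : Prop :=
  (exists k, \dim (krylov A v k) = l) /\
  (forall k, (\dim (krylov A v k) <= l)%N).

(* [x] minimises the residual norm over the affine space x0 + K_k(A, r0);
   membership in that space is expressed as x - x0 \in K_k(A, r0). *)
Definition gmres_iterate n (A : 'M[R]_n) (b x0 : 'cV[R]_n) (k : nat)
    (x : 'cV[R]_n) : Prop :=
  x - x0 \in krylov A (b - A *m x0) k /\
  (forall y : 'cV[R]_n, y - x0 \in krylov A (b - A *m x0) k ->
     enorm (b - A *m x) <= enorm (b - A *m y)).

Definition penrose m n (A : 'M[R]_(m, n)) (X : 'M[R]_(n, m)) : bool :=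
  [&& A *m X *m A == A, X *m A *m X == X,
      (A *m X)^T == A *m X & (X *m A)^T == X *m A].

Lemma gram_unitmx r n (F : 'M[R]_(r, n)) :
  row_free F -> F *m F^T \in unitmx.
Proof.
move=> freeF; rewrite -row_free_unit; apply: inj_row_free => u uG0.
have: (u *m F) *m (u *m F)^T = 0.
  by rewrite trmx_mul mulmxA -(mulmxA u) uG0 mul0mx.
move=> /matrixP/(_ 0 0); rewrite !mxE => sum0.
apply: (row_free_inj freeF); rewrite mul0mx; apply/rowP => j.
rewrite [RHS]mxE.
have sq_ge0 (i : 'I_n) : true -> 0 <= (u *m F) 0 i * (u *m F)^T i 0.
  by move=> _; rewrite [X in _ * X]mxE -expr2 sqr_ge0.
move/eqP: sum0; rewrite psumr_eq0 // => /allP /(_ j).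
rewrite mem_index_enum => /(_ isT) /=.
by rewrite [X in _ * X]mxE mulf_eq0 orbb => /eqP.
Qed.

Lemma penrose_factor m r n (C : 'M[R]_(m, r)) (F : 'M[R]_(r, n)) :
  row_free C^T -> row_free F -> exists X, penrose (C *m F) X.
Proof.
move=> /gram_unitmx; rewrite trmxK => Hu /gram_unitmx Gu.
set G := F *m F^T in Gu; set H := C^T *m C in Hu.
have GT : (invmx G)^T = invmx G by rewrite trmx_inv /G trmx_mul trmxK.
have HT : (invmx H)^T = invmx H by rewrite trmx_inv /H trmx_mul trmxK.
exists (F^T *m invmx G *m (invmx H *m C^T)).
set X := F^T *m _ *m _.
have AX : C *m F *m X = C *m (invmx H *m C^T).
  by rewrite /X -!mulmxA (mulmxA F) (mulKVmx Gu).
have XA : X *m (C *m F) = F^T *m invmx G *m F.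
  by rewrite /X -!mulmxA (mulmxA C^T) (mulKmx Hu).
apply/and4P; split; apply/eqP.
- by rewrite AX -!mulmxA (mulmxA C^T) (mulKmx Hu).
- by rewrite XA /X -!mulmxA (mulmxA F) (mulKVmx Gu).
- by rewrite AX !trmx_mul HT trmxK mulmxA.
- by rewrite XA !trmx_mul GT trmxK mulmxA.
Qed.

Lemma penrose_exists m n (A : 'M[R]_(m, n)) : exists X, penrose A X.
Proof.
rewrite -[A]mulmx_base; apply: penrose_factor (row_base_free A).
by rewrite /row_free mxrank_tr; exact: col_base_full.
Qed.

Lemma penrose_uniq m n (A : 'M[R]_(m, n)) (X Y : 'M[R]_(n, m)) :
  penrose A X -> penrose A Y -> X = Y.
Proof.
move=> /and4P[/eqP X1 /eqP X2 /eqP X3 /eqP X4].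
move=> /and4P[/eqP Y1 /eqP Y2 /eqP Y3 /eqP Y4].
have AXY : A *m X = A *m Y.
  rewrite -X3 -[in LHS]Y1 -(mulmxA (A *m Y)) trmx_mul X3 Y3.
  by rewrite mulmxA X1.
have XYA : X *m A = Y *m A.
  rewrite -X4 -[in LHS]Y1 -mulmxA (mulmxA X) trmx_mul X4 Y4.
  by rewrite -mulmxA (mulmxA A) X1.
by rewrite -X2 XYA -mulmxA AXY mulmxA Y2.
Qed.

(* The Moore-Penrose inverse: the unique matrix satisfying the four Penrose
   equations.  (MathComp's [pinvmx] is only a one-sided partial inverse.) *)
Definition mpinv m n (A : 'M[R]_(m, n)) : 'M[R]_(n, m) :=
  xchoose (penrose_exists A).

Lemma mpinvP m n (A : 'M[R]_(m, n)) : penrose A (mpinv A).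
Proof. exact: xchooseP. Qed.

End RealMatrices.

(* Main.v *)
(* Since range A = range A^T, R^n is the orthogonal sum of range A and ker A, and
   A is injective on range A.  Write r0 = s + z with s in range A and
   z = b - A A^+ b <> 0 in ker A.  As r0 is not in range A while A K_l is
   contained in K_l and in range A, dimensions force A K_l = A K_(l-1), a space
   which A maps onto itself.  It contains A r0 = A w for some w in it, and then
   s = w by injectivity, so s lies in A K_(l-1).  Hence the (l-1)th GMRES
   residual is z.  Finally K_(l-1) lies in <z> + range A, and subtracting the
   z-component of x - x0 leaves a least squares solution in
   range A = range A^T, which is A^+ b. *)
Require Import Defs.
From mathcomp Require Import all_boot all_order all_algebra.
From mathcomp Require Import reals.

Set Implicit Arguments.
Unset Strict Implicit.
Unset Printing Implicit Defensive.

Import Order.TTheory GRing.Theory Num.Theory.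
Local Open Scope ring_scope.

Lemma mulmx_exprS (R : realType) (n : nat) (A : 'M[R]_n) (v : 'cV[R]_n) i :
  A ^+ i.+1 *m v = A *m (A ^+ i *m v).
Proof. by rewrite exprS -[A * _]/(A *m _) mulmxA. Qed.

Lemma krylovS (R : realType) (n : nat) (A : 'M[R]_n) (v : 'cV[R]_n) k :
  krylov A v k.+1 = (krylov A v k + <[A ^+ k *m v]>)%VS.
Proof. by rewrite /krylov mkseqS -cats1 span_cat span_seq1. Qed.

(** Counterpart of [krylovS] that splits off the first generator instead of the last, which brings
    in the image under A. *)
Lemma limg_krylov (R : realType) (n : nat) (A : 'M[R]_n) (v : 'cV[R]_n) k :
  krylov A v k.+1 = (<[v]> + linfun (mulmx A) @: krylov A v k)%VS.
Proof.
rewrite limg_span -span_cons /krylov /mkseq /= expr0.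
rewrite -[1 *m v]/(1%:M *m v) mul1mx -map_comp (iotaDl 1 0) -map_comp.
congr span; congr (_ :: _); apply: eq_map => i /=.
by rewrite lfunE /= mulmx_exprS.
Qed.

Lemma dim_krylov (R : realType) (n : nat) (A : 'M[R]_n) (v : 'cV[R]_n) k :
  (\dim (krylov A v k) <= k)%N.
Proof. by rewrite (leq_trans (dim_span _)) // size_mkseq. Qed.

(** The hypothesis makes K_(j+1) = K_j, so K_j contains v and is mapped into itself by A. *)
Lemma krylov_stationary (R : realType) (n : nat) (A : 'M[R]_n)
    (v : 'cV[R]_n) j k :
  A ^+ j *m v \in krylov A v j -> (krylov A v k <= krylov A v j)%VS.
Proof.
move=> Kj.
have KS : krylov A v j.+1 = krylov A v j by rewrite krylovS; apply/addv_idPl.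
elim: k => [|k IHk]; first by rewrite /krylov span_nil sub0v.
rewrite limg_krylov -[X in (_ <= X)%VS]KS [X in (_ <= X)%VS]limg_krylov.
by rewrite addvS // limgS.
Qed.

(** The maximum is reached at index l itself: for j < l the vector A^j v must be new, since
    otherwise all dimensions would stay at most j. *)
Lemma max_krylov_dimP (R : realType) (n : nat) (A : 'M[R]_n)
    (v : 'cV[R]_n) l :
  max_krylov_dim A v l ->
  \dim (krylov A v l) = l /\ krylov A v l.+1 = krylov A v l.
Proof.
move=> [[k dimk] max_l].
have new j : (j < l)%N -> A ^+ j *m v \notin krylov A v j.
  move=> jl; apply/negP => /(krylov_stationary k)/dimvS.
  by rewrite dimk => /leq_trans/(_ (dim_krylov A v j)); rewrite leqNgt jl.
have ge_dim j : (j <= l)%N -> (j <= \dim (krylov A v j))%N.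
  elim: j => // j IHj jl; apply: leq_ltn_trans (IHj (ltnW jl)) _.
  have sub : (krylov A v j <= krylov A v j.+1)%VS by rewrite krylovS addvSl.
  rewrite ltn_neqAle dimvS // andbT dimv_leqif_eq //.
  apply: contra (new j jl) => /eqP ->.
  by rewrite krylovS (subvP (addvSr _ _)) ?memv_line.
have diml : \dim (krylov A v l) = l.
  by apply/eqP; rewrite eqn_leq dim_krylov ge_dim.
split=> //; apply/esym/eqP.
by rewrite eqEdim krylovS addvSl -krylovS diml max_l.
Qed.

(** Here s + z plays the role of r0; x0 + y will be the competitor whose residual is z. *)
Lemma krylov_preimage (R : realType) (n : nat) (A : 'M[R]_n)
    (s z : 'cV[R]_n) l :
  (mxrange A :&: lker (linfun (mulmx A : 'cV_n -> 'cV_n)) = 0)%VS ->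
  s \in mxrange A -> A *m z = 0 -> s + z \notin mxrange A ->
  max_krylov_dim A (s + z) l ->
  exists2 y, y \in krylov A (s + z) l.-1 & A *m y = s.
Proof.
set f := linfun _; set v := s + z; set K := krylov A v.
move=> RN0 sR Az0 vR /max_krylov_dimP[diml KS].
(* If l = 0 then v = 0 lies in the range; so [l.-1] is a true predecessor. *)
have lt0l : (0 < l)%N.
  case: l diml KS => // _; rewrite limg_krylov {2}/krylov span_nil => K0.
  have : v \in 0%VS by rewrite -K0 (subvP (addvSl _ _)) ?memv_line.
  by rewrite memv0 => /eqP v0; rewrite v0 mem0v in vR.
have vK : v \in K l.
  by rewrite /K -KS limg_krylov (subvP (addvSl _ _)) ?memv_line.
have fK : (f @: K l <= K l)%VS.
  by rewrite /K -[X in (_ <= X)%VS]KS limg_krylov addvSr.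
have fKR U : (f @: U <= mxrange A)%VS by apply: limgS (subvf _).
have ltfK : (\dim (f @: K l) < l)%N.
  rewrite -[X in (_ < X)%N]diml ltn_neqAle dimvS // andbT dimv_leqif_eq //.
  by apply: contra vR => /eqP eqK; apply: (subvP (fKR (K l))); rewrite eqK.
(* K_l is spanned by v and the image of K_(l-1), so that image has codimension at most 1 in K_l. *)
have gefK : (l.-1 <= \dim (f @: K l.-1))%N.
  have : (\dim (K l) <= 1 + \dim (f @: K l.-1))%N.
    rewrite -[in K l](prednK lt0l) /K limg_krylov.
    apply: leq_trans (dimv_add_leqif _ _) _.
    by rewrite leq_add2r dim_vline; case: eqP.
  by rewrite diml -[X in (X <= _)%N](prednK lt0l).
have eqfK : (f @: K l.-1 = f @: K l)%VS.
  apply/eqP; rewrite eqEdim limgS; last first.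
    by rewrite -[in K l](prednK lt0l) /K krylovS addvSl.
  by rewrite (leq_trans _ gefK) // -ltnS prednK.
have ffK : (f @: (f @: K l) = f @: K l)%VS.
  apply/eqP; rewrite eqEdim limgS //= (@limg_dim_eq _ _ _ _ (f @: K l)) //.
  by apply/eqP; rewrite -subv0 -RN0 capvS.
have : f v \in (f @: (f @: K l))%VS by rewrite ffK memv_img.
case/memv_imgP => w wK; rewrite !lfunE /= mulmxDr Az0 addr0 => Asw.
have sw : s = w.
  apply/eqP; rewrite -subr_eq0 -memv0 -RN0 memv_cap.
  rewrite rpredB ?(subvP (fKR _) _ wK) //=.
  by rewrite memv_ker lfunE /= mulmxBr Asw subrr.
move: wK; rewrite -eqfK -sw => /memv_imgP[y yK ->].
by exists y; rewrite ?lfunE.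
Qed.

Lemma dotcv_sum (R : realType) (n : nat) (u : 'cV[R]_n) :
  dotcv u u = \sum_i u i 0 ^+ 2.
Proof. by rewrite /dotcv mxE; apply: eq_bigr => i _; rewrite mxE expr2. Qed.

Lemma dotcv_le0 (R : realType) (n : nat) (u : 'cV[R]_n) :
  (dotcv u u <= 0) = (u == 0).
Proof.
apply/idP/eqP => [|->]; last by rewrite /dotcv mulmx0 mxE.
have sq_ge0 (i : 'I_n) : true -> 0 <= u i 0 ^+ 2 by rewrite sqr_ge0.
rewrite le_eqVlt ltNge dotcv_sum sumr_ge0 // orbF psumr_eq0 // => /allP u0.
apply/colP => i; rewrite mxE; apply/eqP.
by have := u0 i; rewrite mem_index_enum => /(_ isT); rewrite sqrf_eq0.
Qed.

Lemma ler_enorm (R : realType) (n : nat) (u v : 'cV[R]_n) :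
  (enorm u <= enorm v) = (dotcv u u <= dotcv v v).
Proof.
rewrite /enorm -!dotcv_sum ler_sqrt // dotcv_sum sumr_ge0 // => i _.
by rewrite sqr_ge0.
Qed.

Lemma dotcvC (R : realType) (n : nat) (u v : 'cV[R]_n) :
  dotcv u v = dotcv v u.
Proof. by rewrite /dotcv -[v in LHS]trmxK -trmx_mul mxE. Qed.

Lemma dotcvDr (R : realType) (n : nat) (w u v : 'cV[R]_n) :
  dotcv w (u + v) = dotcv w u + dotcv w v.
Proof. by rewrite /dotcv mulmxDr mxE. Qed.

Lemma dotcvDl (R : realType) (n : nat) (w u v : 'cV[R]_n) :
  dotcv (u + v) w = dotcv u w + dotcv v w.
Proof. by rewrite dotcvC dotcvDr !(dotcvC w). Qed.

Lemma dotcvZr (R : realType) (n : nat) (w u : 'cV[R]_n) c :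
  dotcv w (c *: u) = c * dotcv w u.
Proof. by rewrite /dotcv -scalemxAr mxE. Qed.

Lemma dotcv_mulmxr (R : realType) (m n : nat) (A : 'M[R]_(m, n))
    (u : 'cV[R]_m) (v : 'cV[R]_n) :
  dotcv u (A *m v) = dotcv (A^T *m u) v.
Proof. by rewrite /dotcv trmx_mul trmxK mulmxA. Qed.

(** Each column of D is a chosen preimage of a column of A. Transposed, the factorization turns
    range inclusions into kernel inclusions. *)
Lemma mxrange_sub_mul (R : realType) (m n p : nat) (A : 'M[R]_(m, n))
    (B : 'M[R]_(m, p)) :
  (mxrange A <= mxrange B)%VS -> exists D : 'M[R]_(p, n), A = B *m D.
Proof.
move=> /subvP AB.
have colA j : exists x : 'cV[R]_p, col j A == B *m x.
  have /AB/mxrangeP[x ->] : col j A \in mxrange A.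
    by apply/mxrangeP; exists (delta_mx j 0); rewrite colE.
  by exists x.
exists (\matrix_(i, j) xchoose (colA j) i 0); apply/matrixP => i j.
have /eqP/colP/(_ i) := xchooseP (colA j).
by rewrite !mxE => ->; apply: eq_bigr => k _; rewrite mxE.
Qed.

(** With u = A^T w, the square norm of u is the product of A u and w, which vanishes. *)
Lemma mxrange_ker0 (R : realType) (n : nat) (A : 'M[R]_n) (u : 'cV[R]_n) :
  u \in mxrange A^T -> A *m u = 0 -> u = 0.
Proof.
move=> /mxrangeP[w uE] Au0; apply/eqP; rewrite -dotcv_le0.
by rewrite {2}uE dotcv_mulmxr trmxK Au0 dotcvC /dotcv mulmx0 mxE.
Qed.

Theorem corollary4 (R : realType) (n : nat) (A : 'M[R]_n)
    (b x0 x : 'cV[R]_n) (l : nat)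
    (hl : max_krylov_dim A (b - A *m x0) l)
    (hA : mxrange A = mxrange A^T)
    (hb : b \notin mxrange A)
    (hx0 : x0 \in mxrange A)
    (hx : gmres_iterate A b x0 l.-1 x) :
  let r := b - A *m x in
  x - (dotcv r (x - x0) / dotcv r r) *: r = mpinv A *m b.
Proof.
have [/eqP P1 /eqP P2 /eqP P3 /eqP P4] := and4P (mpinvP A).
set X := mpinv A in P1 P2 P3 P4 *.
have [z zE] : exists z, z = b - A *m (X *m b).
  by exists (b - A *m (X *m b)).
have memR (u : 'cV_n) : A *m u \in mxrange A by apply/mxrangeP; exists u.
(* Symmetry of A X gives A^T A X = (A X A)^T = A^T. *)
have ATz : A^T *m z = 0.
  by rewrite zE mulmxBr !mulmxA -(mulmxA A^T A) -P3 -trmx_mul P1 subrr.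
have Az : A *m z = 0.
  have /mxrange_sub_mul[D AD] : (mxrange A^T <= mxrange A)%VS by rewrite hA.
  by rewrite -[A]trmxK AD trmx_mul -mulmxA ATz mulmx0.
have zR u : u \in mxrange A -> dotcv z u = 0.
  by move=> /mxrangeP[w ->]; rewrite dotcv_mulmxr ATz dotcvC /dotcv mulmx0 mxE.
have RN0 : (mxrange A :&: lker (linfun (mulmx A : 'cV_n -> 'cV_n)) = 0)%VS.
  apply/eqP; rewrite -subv0; apply/subvP => u.
  rewrite memv_cap memv_ker lfunE memv0 /= => /andP[uR /eqP Au0].
  by apply/eqP; apply: (mxrange_ker0 (A := A)) => //; rewrite -hA.
have r0E : b - A *m x0 = A *m (X *m b - x0) + z.
  by rewrite zE mulmxBr [RHS]addrC addrA subrK.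
have r0R : A *m (X *m b - x0) + z \notin mxrange A.
  rewrite -r0E; apply: contra hb => r0R.
  by rewrite -(subrK (A *m x0) b) rpredD.
case: hx => xK xmin; rewrite r0E in hl xK xmin.
have [y yK Ay] := krylov_preimage RN0 (memR _) Az r0R hl.
(* The residual of x is z + A d with A d orthogonal to z; comparison with x0 + y forces A d = 0 by
   Pythagoras. *)
have rE : b - A *m x = z.
  have := xmin (x0 + y); rewrite addrC addKr => /(_ yK).
  have -> : b - A *m (x0 + y) = z.
    by rewrite mulmxDr Ay -mulmxDr [x0 + _]addrC subrK -zE.
  have -> : b - A *m x = z + A *m (X *m b - x).
    by rewrite zE mulmxBr addrA subrK.
  set d := X *m b - x.
  rewrite ler_enorm dotcvDr !dotcvDl (dotcvC (A *m d) z) (zR (A *m d)) //.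
  by rewrite addr0 add0r gerDl dotcv_le0 => /eqP ->; rewrite addr0.
(* Among the Krylov generators only r0 itself can have a component along z. *)
have [c [u uR xE]] : exists c, exists2 u, u \in mxrange A & x - x0 = c *: z + u.
  have : x - x0 \in (<[z]> + mxrange A)%VS.
    apply: subvP xK; case: (l.-1) => [|k].
      by rewrite /krylov span_nil sub0v.
    rewrite limg_krylov subv_add -memvE addrC memv_add ?memv_line //=.
    exact: subv_trans (limgS _ (subvf _)) (addvSr _ _).
  by case/memv_addP => _ /vlineP[c ->] [u uR ->]; exists c, u.
have z0 : dotcv z z != 0.
  apply: contra hb => /eqP zz0.
  have : z == 0 by rewrite -dotcv_le0 zz0.
  by rewrite zE => /eqP/subr0_eq ->.
(* As z is orthogonal to u, the correction coefficient is exactly c. *)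
rewrite /= rE xE dotcvDr dotcvZr (zR u) // addr0 mulfK //.
have xE' : x - c *: z = x0 + u.
  by rewrite -[x](subrK x0) xE addrAC [c *: z + u]addrC addrK addrC.
rewrite xE'; apply/eqP; rewrite -subr_eq0; apply/eqP.
(* Both x0 + u and X b lie in the range of A^T, the latter because X b = (X A)^T X b, and A maps
   both to b - z. *)
apply: (mxrange_ker0 (A := A)).
  rewrite -hA rpredB ?rpredD // -P2 hA.
  by apply/mxrangeP; exists (X^T *m (X *m b)); rewrite -P4 trmx_mul !mulmxA.
rewrite -xE' !mulmxBr -scalemxAr Az scaler0 subr0.
by move: rE; rewrite zE => /addrI/oppr_inj ->; rewrite subrr.
Qed.
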